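(* Let $\mathbb{E}$ be an exact category and let $\mathcal{P}\colon \mathbb{C}\hookrightarrow\mathbb{E}$ be a projective cover of $\mathbb{E}$. Then $\mathbb{E}$ is cartesian closed if and only if $\mathbb{C}$ has extensional simple products.
   Context: A category is exact if it has finite limits, regular epis are stable under pullback, and every equivalence relation $(r_1,r_2)\colon R\hookrightarrow X\times X$ has a coequaliser $q$ of $r_1,r_2$ such that $r_1,r_2$ is a kernel pair of $q$. An object $P$ of a category is (regular) projective if every arrow $P\to B$ lifts along every regular epi $A\to B$. A projective cover of an exact category $\mathbb{E}$ is (the inclusion $\mathcal{P}$ of) a full subcategory $\mathcal{P}\colon\mathbb{C}\hookrightarrow\mathbb{E}$ such that $\mathcal{P}X$ is projective in $\mathbb{E}$ for every $X$ in $\mathbb{C}$, and for every $A$ in $\mathbb{E}$ there are $X$ in $\mathbb{C}$ and a regular epi $\mathcal{P}X\to A$. In this situation $\mathbb{C}$ has weak finite limits, so the notions below make sense in $\mathbb{C}$. A weak limit is defined as a limit but without requiring uniqueness of the induced arrow. Let $\mathbb{C}$ have weak finite limits. A pseudo equivalence relation $x_1,x_2\colon\bar X\rightrightarrows X$ consists of arrows $x_1,x_2\colon\bar X\to X$ for which there are $\rho\colon X\to\bar X$, $\sigma\colon\bar X\to\bar X$ and $\tau\colon W\to\bar X$, where $W$ with $p_1,p_2\colon W\to\bar X$ is a weak pullback of $x_2$ and $x_1$ (so $x_2p_1=x_1p_2$), with $x_1\rho=x_2\rho=\mathrm{id}_X$, $x_1\sigma=x_2$, $x_2\sigma=x_1$,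 $x_1\tau=x_1p_1$, $x_2\tau=x_2p_2$. A weak kernel pair of a span $Z\xleftarrow{p_1}V\xrightarrow{p_2}X$ is a pair $v_1,v_2\colon\bar V\to V$ with $p_iv_1=p_iv_2$ for $i=1,2$, weakly universal with this property (it is a pseudo equivalence relation). If $Z\xleftarrow{p_1}V\xrightarrow{p_2}X$ is a weak product and $y_1,y_2\colon\bar Y\rightrightarrows Y$ is a pseudo equivalence relation, an arrow $f\colon V\to Y$ preserves projections with respect to $y_1,y_2$ if, for a weak kernel pair $v_1,v_2\colon\bar V\to V$ of $p_1,p_2$, there is $\bar f\colon\bar V\to\bar Y$ with $y_i\bar f=fv_i$ for $i=1,2$ (this does not depend on the choice of weak kernel pair). Extensional simple product: let $y_1,y_2\colon\bar Y\rightrightarrows Y$ be a pseudo equivalence relation and $Z\xleftarrow{g_1}Y\xrightarrow{g_2}X$ a span with $g_1y_1=g_1y_2$ and $g_2y_1=g_2y_2$. Consider data $D=(W,w,V,q_1,q_2,e)$ where $w\colon W\to Z$, $W\xleftarrow{q_1}V\xrightarrow{q_2}X$ is a weak product, and $e\colon V\to Y$ preserves projections with respect to $y_1,y_2$ and satisfies $g_1e=wq_1$, $g_2e=q_2$. An extensional simple product of $g_1,g_2$ with respect to $y_1,y_2$ is such a $D$ with the property that for every other such $D'=(W',w',V',q_1',q_2',e')$ there are $h\colon W'\to W$ and $k\colon V'\to V$ with $wh=w'$, $q_1k=hq_1'$, $q_2k=q_2'$, $ek=e'$. $\mathbb{C}$ has extensional simple products if an extensional simple product exists for all such $y_1,y_2$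 and $g_1,g_2$. *)

(* Defs.v *)
From Stdlib Require Import List.

Set Implicit Arguments.
Unset Strict Implicit.
Unset Printing Implicit Defensive.

Declare Scope cat_scope.
Delimit Scope cat_scope with cat.

Record Category : Type := {
  Obj :> Type;
  Hom : Obj -> Obj -> Type;
  idn : forall X : Obj, Hom X X;
  comp : forall X Y Z : Obj, Hom Y Z -> Hom X Y -> Hom X Z;
  comp_idl : forall (X Y : Obj) (f : Hom X Y), comp (idn Y) f = f;
  comp_idr : forall (X Y : Obj) (f : Hom X Y), comp f (idn X) = f;
  comp_assoc : forall (X Y Z T : Obj) (f : Hom X Y) (g : Hom Y Z) (h : Hom Z T),
    comp h (comp g f) = comp (comp h g) f
}.

Arguments idn {c} X.
Arguments comp {c X Y Z} g f.

Notation "g ∘ f" := (comp g f) (at level 40, left associativity) : cat_scope.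
Notation "X ~> Y" := (Hom X Y) (at level 90, no associativity) : cat_scope.
Open Scope cat_scope.

Record Functor (J C : Category) : Type := {
  fobj :> J -> C;
  fmap : forall i j : J, (i ~> j) -> (fobj i ~> fobj j);
  fmap_id : forall i : J, fmap (idn i) = idn (fobj i);
  fmap_comp : forall (i j k : J) (f : i ~> j) (g : j ~> k),
    fmap (g ∘ f) = fmap g ∘ fmap f
}.

Arguments fmap {J C} _ {i j} _.

Definition full_subcategory (E : Category) (P : E -> Prop) : Category :=
  {| Obj := {X : E | P X};
     Hom := fun X Y => proj1_sig X ~> proj1_sig Y;
     idn := fun X => idn (proj1_sig X);
     comp := fun X Y Z g f => g ∘ f;
     comp_idl := fun X Y f => comp_idl f;
     comp_idr := fun X Y f => comp_idr f;
     comp_assoc := fun X Y Z T f g h => comp_assoc f g h |}.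

Definition finite_type (T : Type) : Prop := exists s : list T, forall t : T, In t s.

Definition finite_category (J : Category) : Prop :=
  finite_type J /\ forall i j : J, finite_type (i ~> j).

Section Limits.
Variables (J C : Category) (F : Functor J C).

Definition is_cone (L : C) (p : forall i : J, L ~> F i) : Prop :=
  forall (i j : J) (a : i ~> j), fmap F a ∘ p i = p j.

Definition is_limit (L : C) (p : forall i : J, L ~> F i) : Prop :=
  is_cone p /\
  forall (T : C) (t : forall i : J, T ~> F i), is_cone t ->
    exists! u : T ~> L, forall i : J, p i ∘ u = t i.
End Limits.

Definition has_finite_limits (C : Category) : Prop :=
  forall (J : Category) (F : Functor J C), finite_category J ->
    exists (L : C) (p : forall i : J, L ~> F i), is_limit p.

Section Notions.
Variable C : Category.

Definition is_terminal (T : C) : Prop :=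
  forall X : C, exists u : X ~> T, forall v : X ~> T, v = u.

Definition is_product (A B P : C) (p1 : P ~> A) (p2 : P ~> B) : Prop :=
  forall (T : C) (t1 : T ~> A) (t2 : T ~> B),
    exists! u : T ~> P, p1 ∘ u = t1 /\ p2 ∘ u = t2.

Definition is_pullback (A B D P : C) (p1 : P ~> A) (p2 : P ~> B)
    (f : A ~> D) (g : B ~> D) : Prop :=
  f ∘ p1 = g ∘ p2 /\
  forall (T : C) (t1 : T ~> A) (t2 : T ~> B), f ∘ t1 = g ∘ t2 ->
    exists! u : T ~> P, p1 ∘ u = t1 /\ p2 ∘ u = t2.

Definition is_kernel_pair (R X Q : C) (r1 r2 : R ~> X) (q : X ~> Q) : Prop :=
  is_pullback r1 r2 q q.

Definition is_coequalizer (R X Q : C) (r1 r2 : R ~> X) (q : X ~> Q) : Prop :=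
  q ∘ r1 = q ∘ r2 /\
  forall (T : C) (t : X ~> T), t ∘ r1 = t ∘ r2 -> exists! u : Q ~> T, u ∘ q = t.

Definition mono (A B : C) (m : A ~> B) : Prop :=
  forall (T : C) (f g : T ~> A), m ∘ f = m ∘ g -> f = g.

Definition regular_epi (A B : C) (f : A ~> B) : Prop :=
  exists (R : C) (r1 r2 : R ~> A), is_coequalizer r1 r2 f.

Definition is_equivalence_relation (R X : C) (r1 r2 : R ~> X) : Prop :=
  (exists (S : C) (s1 s2 : S ~> X) (m : R ~> S),
     is_product s1 s2 /\ s1 ∘ m = r1 /\ s2 ∘ m = r2 /\ mono m) /\
  (exists rho : X ~> R, r1 ∘ rho = idn X /\ r2 ∘ rho = idn X) /\
  (exists sigma : R ~> R, r1 ∘ sigma = r2 /\ r2 ∘ sigma = r1) /\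
  (exists (W : C) (p1 p2 : W ~> R) (tau : W ~> R),
     is_pullback p1 p2 r2 r1 /\ r1 ∘ tau = r1 ∘ p1 /\ r2 ∘ tau = r2 ∘ p2).

Definition exact_category : Prop :=
  has_finite_limits C /\
  (forall (A B D P : C) (p1 : P ~> A) (p2 : P ~> B) (f : A ~> D) (g : B ~> D),
     is_pullback p1 p2 f g -> regular_epi f -> regular_epi p2) /\
  (forall (R X : C) (r1 r2 : R ~> X), is_equivalence_relation r1 r2 ->
     exists (Q : C) (q : X ~> Q), is_coequalizer r1 r2 q /\ is_kernel_pair r1 r2 q).

Definition projective (P : C) : Prop :=
  forall (A B : C) (e : A ~> B), regular_epi e ->
    forall f : P ~> B, exists g : P ~> A, e ∘ g = f.

Definition is_exponential (X Y Ex P : C) (p1 : P ~> Ex) (p2 : P ~> X) (ev : P ~> Y) :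
    Prop :=
  is_product p1 p2 /\
  forall (W Q : C) (q1 : Q ~> W) (q2 : Q ~> X), is_product q1 q2 ->
  forall f : Q ~> Y,
    exists! h : W ~> Ex,
      (* [k] is [h × id_X] *)
      exists k : Q ~> P, p1 ∘ k = h ∘ q1 /\ p2 ∘ k = q2 /\ ev ∘ k = f.

Definition cartesian_closed : Prop :=
  (exists T : C, is_terminal T) /\
  (forall A B : C, exists (P : C) (p1 : P ~> A) (p2 : P ~> B), is_product p1 p2) /\
  (forall X Y : C, exists (Ex P : C) (p1 : P ~> Ex) (p2 : P ~> X) (ev : P ~> Y),
     is_exponential p1 p2 ev).

Definition is_weak_product (A B P : C) (p1 : P ~> A) (p2 : P ~> B) : Prop :=
  forall (T : C) (t1 : T ~> A) (t2 : T ~> B),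
    exists u : T ~> P, p1 ∘ u = t1 /\ p2 ∘ u = t2.

Definition is_weak_pullback (A B D P : C) (p1 : P ~> A) (p2 : P ~> B)
    (f : A ~> D) (g : B ~> D) : Prop :=
  f ∘ p1 = g ∘ p2 /\
  forall (T : C) (t1 : T ~> A) (t2 : T ~> B), f ∘ t1 = g ∘ t2 ->
    exists u : T ~> P, p1 ∘ u = t1 /\ p2 ∘ u = t2.

Definition is_weak_kernel_pair (Z X V V' : C) (p1 : V ~> Z) (p2 : V ~> X)
    (v1 v2 : V' ~> V) : Prop :=
  (p1 ∘ v1 = p1 ∘ v2 /\ p2 ∘ v1 = p2 ∘ v2) /\
  forall (T : C) (t1 t2 : T ~> V), p1 ∘ t1 = p1 ∘ t2 -> p2 ∘ t1 = p2 ∘ t2 ->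
    exists u : T ~> V', v1 ∘ u = t1 /\ v2 ∘ u = t2.

Definition pseudo_equivalence_relation (X' X : C) (x1 x2 : X' ~> X) : Prop :=
  (exists rho : X ~> X', x1 ∘ rho = idn X /\ x2 ∘ rho = idn X) /\
  (exists sigma : X' ~> X', x1 ∘ sigma = x2 /\ x2 ∘ sigma = x1) /\
  (exists (W : C) (p1 p2 : W ~> X') (tau : W ~> X'),
     is_weak_pullback p1 p2 x2 x1 /\ x1 ∘ tau = x1 ∘ p1 /\ x2 ∘ tau = x2 ∘ p2).

Definition preserves_projections (Z X V Y' Y : C) (p1 : V ~> Z) (p2 : V ~> X)
    (y1 y2 : Y' ~> Y) (f : V ~> Y) : Prop :=
  exists (V' : C) (v1 v2 : V' ~> V), is_weak_kernel_pair p1 p2 v1 v2 /\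
    exists f' : V' ~> Y', y1 ∘ f' = f ∘ v1 /\ y2 ∘ f' = f ∘ v2.

Record ESPData (Y' Y Z X : C) (y1 y2 : Y' ~> Y) (g1 : Y ~> Z) (g2 : Y ~> X) : Type := {
  espW : C;
  espw : espW ~> Z;
  espV : C;
  espq1 : espV ~> espW;
  espq2 : espV ~> X;
  espe : espV ~> Y;
  esp_weak_product : is_weak_product espq1 espq2;
  esp_preserves : preserves_projections espq1 espq2 y1 y2 espe;
  esp_comm1 : g1 ∘ espe = espw ∘ espq1;
  esp_comm2 : g2 ∘ espe = espq2
}.

Definition is_extensional_simple_product (Y' Y Z X : C) (y1 y2 : Y' ~> Y)
    (g1 : Y ~> Z) (g2 : Y ~> X) (D : ESPData y1 y2 g1 g2) : Prop :=
  forall D' : ESPData y1 y2 g1 g2,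
    exists (h : espW D' ~> espW D) (k : espV D' ~> espV D),
      espw D ∘ h = espw D' /\ espq1 D ∘ k = h ∘ espq1 D' /\
      espq2 D ∘ k = espq2 D' /\ espe D ∘ k = espe D'.

Definition has_extensional_simple_products : Prop :=
  forall (Y' Y Z X : C) (y1 y2 : Y' ~> Y) (g1 : Y ~> Z) (g2 : Y ~> X),
    pseudo_equivalence_relation y1 y2 ->
    g1 ∘ y1 = g1 ∘ y2 -> g2 ∘ y1 = g2 ∘ y2 ->
    exists D : ESPData y1 y2 g1 g2, is_extensional_simple_product D.

End Notions.

Definition projective_cover (E : Category) (P : E -> Prop) : Prop :=
  (forall X : full_subcategory P, projective (proj1_sig X)) /\
  (forall A : E, exists (X : full_subcategory P) (f : proj1_sig X ~> A), regular_epi f).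

(* Main.v *)
(** In an exact category with a projective cover P, everything can be tested on generalized
    elements with domain in P; in particular an arrow is a regular epi iff such elements lift
    along it.  A weak product V of W and X in P is then a regular epi V -> W × X, a pseudo
    equivalence relation on Y amounts to the quotient Y -> Q of its image, and an arrow V -> Y
    that preserves projections amounts to an arrow W × X -> Q.  So extensional simple products
    are the same thing as weakly universal sections over X of arrows Q -> Z × X, for arbitrary
    Q ([has_weak_sections]).

    If exponentials exist, such sections are carved out of Z × Q^X by an equalizer.
    Conversely, Q = Z × X × A with Z covering the terminal object gives weak exponentials for X
    in P, while Q the equalizer of two arrows Z × X -> A expresses the universal quantification
    "for all x, u (z, x) = v (z, x)".  The latter cuts weak exponentials for general X out of
    those for a cover of X, and provides the relation of extensional equality whose quotient
    is the exponential. *)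

From Stdlib Require Import List IndefiniteDescription.
Require Import Defs.

Set Implicit Arguments.
Unset Strict Implicit.
Unset Printing Implicit Defensive.

Lemma comp_reassoc (C : Category) (A B D T : C) (g : B ~> D) (f : A ~> B) (k : A ~> D)
    (x : T ~> A) :
  g ∘ f = k -> g ∘ (f ∘ x) = k ∘ x.
Proof. intros <-. apply comp_assoc. Qed.

(** * Terminal object, pullbacks and products as instances of finite limits *)

Definition empty_category : Category.
Proof.
  refine {| Obj := Empty_set; Hom := fun _ _ => Empty_set;
            idn := fun X => X; comp := fun X _ _ _ _ => X |}; intros [].
Defined.

Inductive cospan_obj : Type := LeftFoot | RightFoot | Apex.

Definition cospan_hom (i j : cospan_obj) : Type :=
  match i, j with
  | LeftFoot, LeftFoot | RightFoot, RightFoot | _, Apex => unit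
  | _, _ => Empty_set
  end.

Definition cospan_category : Category.
Proof.
  refine {| Obj := cospan_obj; Hom := cospan_hom;
            idn := fun i => match i with LeftFoot | RightFoot | Apex => tt end;
            comp := fun i j k =>
              match i, j, k return cospan_hom j k -> cospan_hom i j -> cospan_hom i k with
              | LeftFoot, LeftFoot, LeftFoot | RightFoot, RightFoot, RightFoot
              | _, _, Apex => fun _ _ => tt
              | LeftFoot, RightFoot, _ | RightFoot, LeftFoot, _ => fun _ f => match f with end
              | Apex, LeftFoot, _ | Apex, RightFoot, _ => fun _ f => match f with end
              | _, _, _ => fun g _ => match g with end
              end |};
    repeat (intros []); try reflexivity; try (intros []); try reflexivity; simpl; try tauto;
    repeat (intros []); reflexivity.
Defined.

Section FiniteLimits.
Variable C : Category.
Hypothesis fin_lim : has_finite_limits C.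

Lemma terminal_exists : exists T : C, is_terminal T.
Proof.
  unshelve epose (F := {| fobj := fun i : empty_category => match i with end |} : Functor empty_category C);
    try (intros []).
  destruct (@fin_lim _ F) as (L & p & _ & univ).
  - split; [exists nil | ]; intros [].
  - exists L. intros X.
    destruct (univ X (fun i => match i with end)) as (u & _ & uniq); [intros [] | ].
    exists u. intros v. symmetry. apply uniq. intros [].
Qed.

Lemma pullback_exists (A B D : C) (f : A ~> D) (g : B ~> D) :
  exists (L : C) (p1 : L ~> A) (p2 : L ~> B), is_pullback p1 p2 f g.
Proof.
  pose (ob := fun i : cospan_category =>
    match i with LeftFoot => A | RightFoot => B | Apex => D end).
  unshelve epose (F := {| fobj := ob; fmap := fun i j =>
      match i, j return cospan_hom i j -> (ob i ~> ob j) with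
      | LeftFoot, LeftFoot => fun _ => idn A
      | RightFoot, RightFoot => fun _ => idn B
      | Apex, Apex => fun _ => idn D
      | LeftFoot, Apex => fun _ => f
      | RightFoot, Apex => fun _ => g
      | _, _ => fun a => match a with end
      end |} : Functor cospan_category C).
  - intros []; reflexivity.
  - intros [] [] []; simpl; try (intros []; fail); try (intros ? []; fail); intros;
      rewrite ?comp_idl, ?comp_idr; reflexivity.
  - destruct (@fin_lim _ F) as (L & p & cone & univ).
    + split.
      * exists (LeftFoot :: RightFoot :: Apex :: nil). intros []; simpl; tauto.
      * intros [] []; (exists nil; now intros []) || (exists (tt :: nil); intros []; now left).
    + exists L, (p LeftFoot), (p RightFoot).
      pose proof (cone LeftFoot Apex tt) as cone_l.
      pose proof (cone RightFoot Apex tt) as cone_r.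
      simpl in cone_l, cone_r. split; [congruence | ].
      intros T t1 t2 H.
      destruct (univ T (fun i => match i return T ~> ob i with
        | LeftFoot => t1 | RightFoot => t2 | Apex => f ∘ t1 end)) as (u & Hu & uniq).
      { intros [] [] a; simpl in *; try destruct a; rewrite ?comp_idl; congruence. }
      exists u. split; [exact (conj (Hu LeftFoot) (Hu RightFoot)) | ].
      intros v [H1 H2]. apply uniq. intros []; [exact H1 | exact H2 | ].
      simpl. change (p Apex ∘ v = f ∘ t1). now rewrite <- cone_l, <- comp_assoc, H1.
Qed.

(** A product is a pullback over a terminal object, where every square commutes. *)
Lemma product_exists (A B : C) :
  exists (L : C) (p1 : L ~> A) (p2 : L ~> B), is_product p1 p2.
Proof.
  destruct terminal_exists as [One term].
  destruct (term A) as [a _], (term B) as [b _].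
  destruct (pullback_exists a b) as (L & p1 & p2 & _ & univ).
  exists L, p1, p2. intros T t1 t2. apply univ.
  destruct (term T) as [u uniq]. now rewrite (uniq (a ∘ t1)), (uniq (b ∘ t2)).
Qed.

End FiniteLimits.

(** * Chosen binary products and exponentials relative to them *)

Class binary_products (C : Category) : Type := {
  prod : C -> C -> C;
  pr1 : forall A B : C, prod A B ~> A;
  pr2 : forall A B : C, prod A B ~> B;
  pair : forall T A B : C, (T ~> A) -> (T ~> B) -> (T ~> prod A B);
  pr1_pair : forall (T A B : C) (f : T ~> A) (g : T ~> B), pr1 A B ∘ pair f g = f;
  pr2_pair : forall (T A B : C) (f : T ~> A) (g : T ~> B), pr2 A B ∘ pair f g = g;
  pair_ext : forall (T A B : C) (u v : T ~> prod A B),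
    pr1 A B ∘ u = pr1 A B ∘ v -> pr2 A B ∘ u = pr2 A B ∘ v -> u = v
}.

Arguments pr1 {C _ A B}.
Arguments pr2 {C _ A B}.
Arguments pair {C _ T A B} f g.
Notation "A × B" := (prod A B) (at level 40, left associativity) : cat_scope.
Notation "⟨ f , g ⟩" := (pair f g) (at level 0, format "⟨ f ,  g ⟩") : cat_scope.
Notation "f ⋉ X" := (⟨f ∘ pr1, pr2 (B := X)⟩) (at level 35, X at level 0) : cat_scope.
Notation "X ⋊ f" := (⟨pr1 (A := X), f ∘ pr2⟩) (at level 35, f at level 0) : cat_scope.

(** Products are only known to exist, so a choice principle turns them into operations, which allow
    equational rewriting. The conclusion stays propositional through [inhabited]. *)
Lemma binary_products_of_exists (C : Category) :
  (forall A B : C, exists (L : C) (p1 : L ~> A) (p2 : L ~> B), is_product p1 p2) ->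
  inhabited (binary_products C).
Proof.
  intros H.
  assert (H' : forall A B : C, {S : {L : C & ((L ~> A) * (L ~> B))%type} |
    is_product (fst (projT2 S)) (snd (projT2 S))}).
  { intros A B. apply constructive_indefinite_description.
    destruct (H A B) as (L & p1 & p2 & Hp).
    now exists (existT _ L (p1, p2)). }
  assert (K : forall (T A B : C) (f : T ~> A) (g : T ~> B),
    {u : T ~> projT1 (proj1_sig (H' A B)) |
      fst (projT2 (proj1_sig (H' A B))) ∘ u = f /\
      snd (projT2 (proj1_sig (H' A B))) ∘ u = g}).
  { intros T A B f g. apply constructive_indefinite_description.
    destruct (proj2_sig (H' A B) T f g) as (u & Hu & _). now exists u. }
  constructor.
  unshelve refine {| prod := fun A B => projT1 (proj1_sig (H' A B));
    pr1 := fun A B => fst (projT2 (proj1_sig (H' A B)));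
    pr2 := fun A B => snd (projT2 (proj1_sig (H' A B)));
    pair := fun T A B f g => proj1_sig (K T A B f g) |}.
  - intros T A B f g. apply (proj2_sig (K T A B f g)).
  - intros T A B f g. apply (proj2_sig (K T A B f g)).
  - intros T A B u v H1 H2.
    destruct (proj2_sig (H' A B) T (fst (projT2 (proj1_sig (H' A B))) ∘ v)
      (snd (projT2 (proj1_sig (H' A B))) ∘ v)) as (w & _ & uniq).
    transitivity w; [symmetry | ]; apply uniq; auto.
Qed.

Lemma pair_comp (C : Category) {BP : binary_products C} (S T A B : C)
    (f : T ~> A) (g : T ~> B) (h : S ~> T) :
  ⟨f, g⟩ ∘ h = ⟨f ∘ h, g ∘ h⟩ :> (S ~> A × B).
Proof. apply pair_ext; rewrite ?comp_assoc, ?pr1_pair, ?pr2_pair; reflexivity. Qed.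

Lemma pair_eta (C : Category) {BP : binary_products C} (T A B : C) (u : T ~> A × B) :
  ⟨pr1 ∘ u, pr2 ∘ u⟩ = u.
Proof. apply pair_ext; rewrite ?pr1_pair, ?pr2_pair; reflexivity. Qed.

Lemma pair_pr (C : Category) {BP : binary_products C} (A B : C) :
  ⟨pr1, pr2⟩ = idn (A × B).
Proof. apply pair_ext; rewrite ?pr1_pair, ?pr2_pair, ?comp_idr; reflexivity. Qed.

Hint Rewrite <- comp_assoc : cat.
Hint Rewrite comp_idl comp_idr @pair_comp @pr1_pair @pr2_pair @pair_eta @pair_pr : cat.

Ltac cat := autorewrite with cat.
Tactic Notation "cat" "in" hyp(H) := autorewrite with cat in H.

Section ChosenProducts.
Context (C : Category) {BP : binary_products C}.

Lemma chosen_is_product (A B : C) : is_product (pr1 (A := A) (B := B)) pr2.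
Proof.
  intros T t1 t2. exists ⟨t1, t2⟩. split; [now cat | ].
  intros v [<- <-]. now cat.
Qed.

(** Here the universal property is an equation about chosen products, whereas [is_exponential]
    ranges over all products; the lemmas below pass between the two. *)
Definition is_chosen_exponential (X Y Ex : C) (ev : Ex × X ~> Y) : Prop :=
  forall (W : C) (f : W × X ~> Y), exists! h : W ~> Ex, ev ∘ (h ⋉ X) = f.

Lemma product_comparison (A B L : C) (p1 : L ~> A) (p2 : L ~> B) :
  is_product p1 p2 ->
  exists i : A × B ~> L,
    p1 ∘ i = pr1 /\ p2 ∘ i = pr2 /\ i ∘ ⟨p1, p2⟩ = idn L.
Proof.
  intros H. destruct (H _ pr1 pr2) as (i & [H1 H2] & _). exists i.
  repeat split; trivial.
  destruct (H _ p1 p2) as (v & _ & uniq).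
  transitivity v; [symmetry | ]; apply uniq; rewrite ?comp_assoc, ?H1, ?H2; cat; auto.
Qed.

Lemma exponential_of_chosen (X Y Ex : C) (ev : Ex × X ~> Y) :
  is_chosen_exponential ev -> is_exponential pr1 pr2 ev.
Proof.
  intros H. split; [apply chosen_is_product | ].
  intros W Q q1 q2 HQ f.
  destruct (product_comparison HQ) as (i & Hi1 & Hi2 & Hi).
  (* The projections force [k] to be [⟨h ∘ q1, q2⟩], so the existential statement is an equation in
     [h], transported along the comparison [i]. *)
  assert (key : forall h : W ~> Ex, (exists k : Q ~> Ex × X,
      pr1 ∘ k = h ∘ q1 /\ pr2 ∘ k = q2 /\ ev ∘ k = f) <-> ev ∘ (h ⋉ X) = f ∘ i).
  { intros h. split.
    - intros (k & H1 & H2 & <-). rewrite <- comp_assoc. f_equal.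
      apply pair_ext; cat; rewrite comp_assoc, ?H1, ?H2; cat; now rewrite ?Hi1, ?Hi2.
    - intros Hh. exists ⟨h ∘ q1, q2⟩. cat. repeat split; trivial.
      transitivity (f ∘ i ∘ ⟨q1, q2⟩); [rewrite <- Hh; now cat | ].
      rewrite <- comp_assoc, Hi. now cat. }
  destruct (H W (f ∘ i)) as (h & Hh & uniq).
  exists h. split; [now apply key | intros h' Hh'; now apply uniq, key].
Qed.

Lemma chosen_of_exponential (X Y Ex L : C) (p1 : L ~> Ex) (p2 : L ~> X) (ev : L ~> Y) :
  is_exponential p1 p2 ev -> exists ev' : Ex × X ~> Y, is_chosen_exponential ev'.
Proof.
  intros [HL H].
  destruct (product_comparison HL) as (i & Hi1 & Hi2 & Hi).
  exists (ev ∘ i). intros W f.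
  destruct (H W _ _ _ (chosen_is_product (A := W) (B := X)) f) as (h & (k & Hk1 & Hk2 & Hk) & uniq).
  exists h. split.
  - rewrite <- Hk, <- Hk1. rewrite <- Hk2 at 1. rewrite <- pair_comp, <- comp_assoc.
    now rewrite (comp_assoc k), Hi, comp_idl.
  - intros h' Hh'. apply uniq. exists (i ∘ (h' ⋉ X)).
    rewrite !comp_assoc, Hi1, Hi2. cat. repeat split; trivial.
    now rewrite <- Hh', comp_assoc.
Qed.

End ChosenProducts.

(** * Cancellation for pullbacks and regular epis, and diagonal fill-in *)

Lemma pullback_ext (C : Category) (A B D L : C) (p1 : L ~> A) (p2 : L ~> B)
    (f : A ~> D) (g : B ~> D) (T : C) (u v : T ~> L) :
  is_pullback p1 p2 f g -> p1 ∘ u = p1 ∘ v -> p2 ∘ u = p2 ∘ v -> u = v.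
Proof.
  intros [comm univ] H1 H2.
  destruct (univ T (p1 ∘ v) (p2 ∘ v)) as (w & _ & uniq).
  - now rewrite !comp_assoc, comm.
  - transitivity w; [symmetry | ]; apply uniq; auto.
Qed.

Lemma regular_epi_cancel (C : Category) (A B D : C) (c : A ~> B) (u v : B ~> D) :
  regular_epi c -> u ∘ c = v ∘ c -> u = v.
Proof.
  intros (R & r1 & r2 & comm & univ) H.
  destruct (univ D (v ∘ c)) as (w & _ & uniq).
  - now rewrite <- !comp_assoc, comm.
  - transitivity w; [symmetry | ]; now apply uniq.
Qed.

(** Since [m ∘ f] factors through [c] and [m] is monic, [f] identifies the two arrows whose
    coequalizer is [c]. *)
Lemma regular_epi_mono_fill (C : Category) (U W R S : C) (c : U ~> W) (f : U ~> R)
    (m : R ~> S) (g : W ~> S) :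
  regular_epi c -> mono m -> m ∘ f = g ∘ c -> exists h : W ~> R, h ∘ c = f /\ m ∘ h = g.
Proof.
  intros Hc Hm H. pose proof Hc as (K & k1 & k2 & comm & univ).
  destruct (univ R f) as (h & Hh & _).
  - apply Hm. now rewrite !comp_assoc, H, <- !comp_assoc, comm.
  - exists h. split; trivial.
    apply (regular_epi_cancel Hc). now rewrite <- comp_assoc, Hh.
Qed.

(** * Regular epis, images and quotients tested on elements with domain in [P] *)

Section ProjectiveCover.
Context (E : Category) {BP : binary_products E} (P : E -> Prop).
Hypothesis exact : exact_category E.
Hypothesis proj_cover : projective_cover P.

Lemma cover_exists (A : E) : exists (U : E) (c : U ~> A), P U /\ regular_epi c.
Proof. destruct (proj2 proj_cover A) as ([U HU] & c & Hc). now exists U, c. Qed.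

Lemma projective_lift (U A B : E) (e : A ~> B) (f : U ~> B) :
  P U -> regular_epi e -> exists g : U ~> A, e ∘ g = f.
Proof. intros HU He. exact (proj1 proj_cover (exist _ U HU) A B e He f). Qed.

(** A cover of [A] is itself such an element, and regular epis can be cancelled. *)
Lemma eq_of_elements (A B : E) (f g : A ~> B) :
  (forall (U : E) (a : U ~> A), P U -> f ∘ a = g ∘ a) -> f = g.
Proof.
  intros H. destruct (cover_exists A) as (U & c & HU & Hc).
  exact (regular_epi_cancel Hc (H U c HU)).
Qed.

Lemma mono_of_elements (A B : E) (m : A ~> B) :
  (forall (U : E) (a b : U ~> A), P U -> m ∘ a = m ∘ b -> a = b) -> mono m.
Proof.
  intros H T f g Hfg. apply eq_of_elements. intros U a HU.
  apply H; trivial. now rewrite !comp_assoc, Hfg.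
Qed.

Lemma regular_epi_descent (A B D : E) (c : A ~> B) (t : A ~> D) :
  regular_epi c ->
  (forall (U : E) (a b : U ~> A), P U -> c ∘ a = c ∘ b -> t ∘ a = t ∘ b) ->
  exists u : B ~> D, u ∘ c = t.
Proof.
  intros (R & r1 & r2 & comm & univ) H.
  destruct (univ D t) as (u & Hu & _).
  - apply eq_of_elements. intros U a HU. rewrite <- !comp_assoc. apply H; trivial.
    now rewrite !comp_assoc, comm.
  - now exists u.
Qed.

Lemma kernel_pair_equivalence (A B K : E) (f : A ~> B) (k1 k2 : K ~> A) :
  is_kernel_pair k1 k2 f -> is_equivalence_relation k1 k2.
Proof.
  intros HK. pose proof HK as [comm univ]. split; [ | split; [ | split]].
  - exists (A × A), pr1, pr2, ⟨k1, k2⟩. cat.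
    split; [apply chosen_is_product | ]. repeat split; trivial.
    intros T u v H. cat in H.
    apply (pullback_ext HK).
    + generalize (f_equal (fun x => pr1 ∘ x) H). now cat.
    + generalize (f_equal (fun x => pr2 ∘ x) H). now cat.
  - destruct (univ A (idn A) (idn A) eq_refl) as (rho & H & _). now exists rho.
  - destruct (univ K k2 k1 (eq_sym comm)) as (sigma & H & _). now exists sigma.
  - destruct (pullback_exists (proj1 exact) k2 k1) as (W & p1 & p2 & HW).
    destruct (univ W (k1 ∘ p1) (k2 ∘ p2)) as (tau & H & _).
    + now rewrite !comp_assoc, comm, <- (comp_assoc p1), (proj1 HW), comp_assoc, comm.
    + now exists W, p1, p2, tau.
Qed.

(** The image is the quotient of the kernel pair of [f]. Two elements of [Q] with the same value
    under [m] lift to [A], where they form an element of the kernel pair; hence [q] identifies the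
    lifts. *)
Lemma regular_mono_factorization (A B : E) (f : A ~> B) :
  exists (Q : E) (q : A ~> Q) (m : Q ~> B), regular_epi q /\ mono m /\ m ∘ q = f.
Proof.
  destruct (pullback_exists (proj1 exact) f f) as (K & k1 & k2 & HK).
  destruct (proj2 (proj2 exact) K A k1 k2 (kernel_pair_equivalence HK)) as (Q & q & Hq & _).
  assert (Hqr : regular_epi q) by now exists K, k1, k2.
  destruct (proj2 Hq B f (proj1 HK)) as (m & Hm & _).
  exists Q, q, m. repeat split; trivial.
  apply mono_of_elements. intros U a b HU Hab.
  destruct (projective_lift a HU Hqr) as [a' <-], (projective_lift b HU Hqr) as [b' <-].
  rewrite !comp_assoc, Hm in Hab.
  destruct (proj2 HK U a' b' Hab) as (d & [<- <-] & _).
  now rewrite !comp_assoc, (proj1 Hq).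
Qed.

(** A cover of [B] lifts along [f], hence factors through the image. Diagonal fill-in gives a
    section [n] of the mono [m], which is thus invertible, and [f] inherits the coequalizer
    presentation of [q]. *)
Lemma regular_epi_of_lifts (A B : E) (f : A ~> B) :
  (forall (U : E) (b : U ~> B), P U -> exists a : U ~> A, f ∘ a = b) -> regular_epi f.
Proof.
  intros H. destruct (regular_mono_factorization f) as (Q & q & m & Hq & Hm & <-).
  destruct (cover_exists B) as (U & c & HU & Hc).
  destruct (H U c HU) as [d Hd].
  destruct (regular_epi_mono_fill (f := q ∘ d) (m := m) (g := idn B) Hc Hm) as (n & _ & Hn).
  { now rewrite comp_idl, comp_assoc. }
  assert (Hn' : n ∘ m = idn Q).
  { apply Hm. now rewrite comp_assoc, Hn, comp_idl, comp_idr. }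
  destruct Hq as (R & r1 & r2 & comm & univ).
  exists R, r1, r2. split; [now rewrite <- !comp_assoc, comm | ].
  intros T t Ht. destruct (univ T t Ht) as (u & Hu & uniq).
  exists (u ∘ n). split.
  - now rewrite comp_assoc, <- (comp_assoc m), Hn', comp_idr.
  - intros v Hv. rewrite (uniq (v ∘ m)); [ | now rewrite <- comp_assoc].
    now rewrite <- comp_assoc, Hn, comp_idr.
Qed.

Lemma regular_epi_times (A B X : E) (c : A ~> B) : regular_epi c -> regular_epi (c ⋉ X).
Proof.
  intros Hc. apply regular_epi_of_lifts. intros U b HU.
  destruct (projective_lift (pr1 ∘ b) HU Hc) as [a Ha].
  exists ⟨a, pr2 ∘ b⟩. cat. rewrite Ha. now cat.
Qed.

Lemma times_regular_epi (A B X : E) (c : A ~> B) : regular_epi c -> regular_epi (X ⋊ c).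
Proof.
  intros Hc. apply regular_epi_of_lifts. intros U b HU.
  destruct (projective_lift (pr2 ∘ b) HU Hc) as [a Ha].
  exists ⟨pr1 ∘ b, a⟩. cat. rewrite Ha. now cat.
Qed.

(** The equalizer arises as the pullback of [⟨f, g⟩] along the diagonal of [B]. *)
Lemma weak_equalizer_exists (A B : E) (f g : A ~> B) :
  exists (K : E) (k : K ~> A), f ∘ k = g ∘ k /\
    forall (T : E) (t : T ~> A), f ∘ t = g ∘ t -> exists s : T ~> K, k ∘ s = t.
Proof.
  destruct (pullback_exists (proj1 exact) ⟨f, g⟩ ⟨idn B, idn B⟩) as (K & k & b & comm & univ).
  cat in comm. exists K, k. split.
  - transitivity b.
    + generalize (f_equal (fun x => pr1 ∘ x) comm). now cat.
    + generalize (f_equal (fun x => pr2 ∘ x) comm). now cat.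
  - intros T t H. destruct (univ T t (f ∘ t)) as (s & [Hs _] & _).
    + cat. now rewrite H.
    + now exists s.
Qed.

(** The image [R] of [⟨y1, y2⟩] is an equivalence relation, and [q] is its effective quotient.
    Elements identified by [q] give an element of [R], which lifts to [Y']. Transitivity is asked on
    elements only, so that the lemma serves both relations in the subcategory and extensional
    equality on weak exponentials. *)
Lemma pseudo_quotient_exists (Y' Y : E) (y1 y2 : Y' ~> Y) :
  (exists rho : Y ~> Y', y1 ∘ rho = idn Y /\ y2 ∘ rho = idn Y) ->
  (exists sigma : Y' ~> Y', y1 ∘ sigma = y2 /\ y2 ∘ sigma = y1) ->
  (forall (U : E) (a b : U ~> Y'), P U -> y2 ∘ a = y1 ∘ b ->
    exists t : U ~> Y', y1 ∘ t = y1 ∘ a /\ y2 ∘ t = y2 ∘ b) ->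
  exists (Q : E) (q : Y ~> Q), regular_epi q /\ q ∘ y1 = q ∘ y2 /\
    forall (U : E) (a b : U ~> Y), P U -> q ∘ a = q ∘ b ->
      exists d : U ~> Y', y1 ∘ d = a /\ y2 ∘ d = b.
Proof.
  intros (rho & Hr1 & Hr2) (sigma & Hs1 & Hs2) trans.
  destruct (regular_mono_factorization ⟨y1, y2⟩) as (R & p & m & Hp & Hm & Hmp).
  assert (Hp1 : pr1 ∘ m ∘ p = y1) by (rewrite <- comp_assoc, Hmp; now cat).
  assert (Hp2 : pr2 ∘ m ∘ p = y2) by (rewrite <- comp_assoc, Hmp; now cat).
  destruct (proj2 (proj2 exact) R Y (pr1 ∘ m) (pr2 ∘ m)) as (Q & q & Hq & HK).
  - split; [ | split; [ | split]].
    + exists (Y × Y), pr1, pr2, m. repeat split; trivial. apply chosen_is_product.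
    + exists (p ∘ rho). now rewrite !comp_assoc, Hp1, Hp2.
    + destruct (regular_epi_mono_fill (c := p) (m := m) (f := p ∘ sigma)
        (g := ⟨pr2 ∘ m, pr1 ∘ m⟩) Hp Hm) as (s & _ & Hs).
      * rewrite pair_comp, Hp1, Hp2, comp_assoc, Hmp, pair_comp. now rewrite Hs1, Hs2.
      * exists s. rewrite <- !comp_assoc, Hs. now cat.
    (* Over a cover of [W] both components lift to [Y'], where [trans] composes them; diagonal
       fill-in brings the composite down to [W]. *)
    + destruct (pullback_exists (proj1 exact) (pr2 ∘ m) (pr1 ∘ m)) as (W & w1 & w2 & HW).
      destruct (cover_exists W) as (U & c & HU & Hc).
      destruct (projective_lift (w1 ∘ c) HU Hp) as [a Ha].
      destruct (projective_lift (w2 ∘ c) HU Hp) as [b Hb].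
      destruct (trans U a b HU) as (t & Ht1 & Ht2).
      { rewrite <- Hp1, <- Hp2, <- 2 (comp_assoc _ p), Ha, Hb, !(comp_assoc c).
        now rewrite (proj1 HW). }
      destruct (regular_epi_mono_fill (c := c) (m := m) (f := p ∘ t)
        (g := ⟨pr1 ∘ m ∘ w1, pr2 ∘ m ∘ w2⟩) Hc Hm) as (tau & _ & Htau).
      * rewrite comp_assoc, Hmp, !pair_comp, Ht1, Ht2, <- Hp1, <- Hp2.
        now rewrite <- 2 (comp_assoc _ p), Ha, Hb, !comp_assoc.
      * exists W, w1, w2, tau. split; [exact HW | ].
        rewrite <- 2 (comp_assoc tau), Htau. cat. now split.
  - exists Q, q. split; [ | split].
    + now exists R, (pr1 ∘ m), (pr2 ∘ m).
    + now rewrite <- Hp1, <- Hp2, !(comp_assoc p), (proj1 Hq).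
    + intros U a b HU Hab. destruct (proj2 HK U a b Hab) as (r & [Hra Hrb] & _).
      destruct (projective_lift r HU Hp) as [d <-].
      exists d. now rewrite !(comp_assoc d), Hp1, Hp2 in *.
Qed.


(** * Weak products and preservation of projections, read in [E] *)

Local Notation FP := (full_subcategory P).
Local Notation ob := (exist P).

(** Both sides express that elements of [W × X] with domain in [P] lift to [V]. *)
Lemma weak_product_regular_epi (W X V : E) (HW : P W) (HX : P X) (HV : P V)
    (q1 : V ~> W) (q2 : V ~> X) :
  @is_weak_product FP (ob W HW) (ob X HX) (ob V HV) q1 q2 <-> regular_epi ⟨q1, q2⟩.
Proof.
  split.
  - intros H. apply regular_epi_of_lifts. intros U b HU.
    destruct (H (ob U HU) (pr1 ∘ b) (pr2 ∘ b)) as (a & Ha1 & Ha2); cbn in *.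
    exists a. rewrite pair_comp, Ha1, Ha2. now cat.
  - intros H [U HU] t1 t2; cbn in *.
    destruct (projective_lift ⟨t1, t2⟩ HU H) as [a Ha]. cat in Ha.
    exists a. split.
    + generalize (f_equal (fun x => pr1 ∘ x) Ha). now cat.
    + generalize (f_equal (fun x => pr2 ∘ x) Ha). now cat.
Qed.

(** The hypotheses say that [Y'] weakly represents the kernel pair of [q]. The elementwise condition
    is what makes [q ∘ f] descend along [⟨p1, p2⟩] once the latter is a regular epi. *)
Lemma preserves_projections_elements (Z X V Y' Y Q : E) (HZ : P Z) (HX : P X) (HV : P V)
    (HY' : P Y') (HY : P Y) (p1 : V ~> Z) (p2 : V ~> X) (y1 y2 : Y' ~> Y) (f : V ~> Y)
    (q : Y ~> Q) :
  q ∘ y1 = q ∘ y2 ->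
  (forall (U : E) (a b : U ~> Y), P U -> q ∘ a = q ∘ b ->
    exists d : U ~> Y', y1 ∘ d = a /\ y2 ∘ d = b) ->
  @preserves_projections FP (ob Z HZ) (ob X HX) (ob V HV) (ob Y' HY') (ob Y HY) p1 p2 y1 y2 f <->
  forall (U : E) (a b : U ~> V), P U -> ⟨p1, p2⟩ ∘ a = ⟨p1, p2⟩ ∘ b ->
    q ∘ (f ∘ a) = q ∘ (f ∘ b).
Proof.
  intros Hq Hq'. split.
  - intros ([V' HV'] & v1 & v2 & [_ univ] & f' & Hf1 & Hf2) U a b HU Hab; cbn in *.
    cat in Hab.
    destruct (univ (ob U HU) a b) as (u & Hua & Hub).
    + generalize (f_equal (fun x => pr1 ∘ x) Hab). now cat.
    + generalize (f_equal (fun x => pr2 ∘ x) Hab). now cat.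
    + cbn in *. subst a b. now rewrite (comp_reassoc u (eq_sym Hf1)), (comp_reassoc u (eq_sym Hf2)),
        !comp_assoc, Hq.
  - intros H.
    (* A weak kernel pair in the subcategory is a cover of the kernel pair in [E]. *)
    destruct (pullback_exists (proj1 exact) (⟨p1, p2⟩ : V ~> Z × X) ⟨p1, p2⟩)
      as (K & k1 & k2 & comm & univ).
    destruct (cover_exists K) as (V' & c & HV' & Hc).
    destruct (Hq' V' (f ∘ (k1 ∘ c)) (f ∘ (k2 ∘ c)) HV') as (f' & Hf).
    { apply H; trivial. now rewrite !comp_assoc, comm. }
    exists (ob V' HV'), (k1 ∘ c), (k2 ∘ c); cbn.
    split; [split; [split | ] | now exists f'].
    + generalize (f_equal (fun x => pr1 ∘ (x ∘ c)) comm). now cat.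
    + generalize (f_equal (fun x => pr2 ∘ (x ∘ c)) comm). now cat.
    + intros [T HT] t1 t2 H1 H2; cbn in *.
      destruct (univ T t1 t2) as (u & [<- <-] & _).
      * cat. now rewrite H1, H2.
      * destruct (projective_lift u HT Hc) as [u' <-].
        exists u'. now rewrite !comp_assoc.
Qed.

(** Unlike in extensional simple products, [Q] is any object of [E], with no relation on it. *)
Definition has_weak_sections : Prop :=
  forall (Q Z X : E) (g1 : Q ~> Z) (g2 : Q ~> X), P Z -> P X ->
  exists (W : E) (w : W ~> Z) (s : W × X ~> Q),
    P W /\ g1 ∘ s = w ∘ pr1 /\ g2 ∘ s = pr2 /\
    forall (T : E) (t : T ~> Z) (s' : T × X ~> Q), P T ->
      g1 ∘ s' = t ∘ pr1 -> g2 ∘ s' = pr2 ->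
      exists h : T ~> W, w ∘ h = t /\ s ∘ (h ⋉ X) = s'.

(** * Extensional simple products and weak sections determine each other *)

Lemma weak_sections_of_simple_products :
  has_extensional_simple_products FP -> has_weak_sections.
Proof.
  intros ESP Q Z X g1 g2 HZ HX.
  (* [Q] is presented inside the subcategory by a cover [Y] and a cover [Y'] of the kernel pair of
     [c]. *)
  destruct (cover_exists Q) as (Y & c & HY & Hc).
  destruct (pullback_exists (proj1 exact) c c) as (K & k1 & k2 & comm & univ).
  destruct (cover_exists K) as (Y' & d & HY' & Hd).
  assert (Hy : c ∘ (k1 ∘ d) = c ∘ (k2 ∘ d)) by now rewrite !comp_assoc, comm.
  assert (Hy' : forall (U : E) (a b : U ~> Y), P U -> c ∘ a = c ∘ b ->
    exists d' : U ~> Y', (k1 ∘ d) ∘ d' = a /\ (k2 ∘ d) ∘ d' = b).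
  { intros U a b HU Hab. destruct (univ U a b Hab) as (u & [<- <-] & _).
    destruct (projective_lift u HU Hd) as [u' <-]. exists u'. now rewrite !comp_assoc. }
  revert Hy Hy'. generalize (k1 ∘ d) (k2 ∘ d). clear K k1 k2 comm univ d Hd.
  intros y1 y2 Hy Hy'.
  destruct (ESP (ob Y' HY') (ob Y HY) (ob Z HZ) (ob X HX) y1 y2 (g1 ∘ c) (g2 ∘ c)) as [D HD].
  - split; [ | split]; cbn.
    + apply Hy'; trivial.
    + apply Hy'; auto.
    + destruct (pullback_exists (proj1 exact) y2 y1) as (W & w1 & w2 & HW).
      destruct (cover_exists W) as (U & u & HU & Hu).
      destruct (Hy' U (y1 ∘ (w1 ∘ u)) (y2 ∘ (w2 ∘ u)) HU) as (tau & Htau).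
      { now rewrite 2 comp_assoc, Hy, <- 2 comp_assoc, (comp_assoc u), (proj1 HW),
          !comp_assoc, Hy. }
      exists (ob U HU), (w1 ∘ u), (w2 ∘ u), tau; cbn. split; [split | exact Htau]; cbn.
      * now rewrite !comp_assoc, (proj1 HW).
      * intros [T HT] t1 t2 Ht; cbn in *.
        destruct (proj2 HW T t1 t2 Ht) as (v & [<- <-] & _).
        destruct (projective_lift v HT Hu) as [v' <-]. exists v'. now rewrite !comp_assoc.
  - cbn. now rewrite <- !comp_assoc, Hy.
  - cbn. now rewrite <- !comp_assoc, Hy.
  - destruct D as [[W HW] w [V HV] q1 q2 e Hwp Hpres H1 H2]; cbn in *.
    pose proof (proj1 (weak_product_regular_epi _ _ _ _ _) Hwp) as Hqq; cbn in Hqq.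
    pose proof (proj1 (preserves_projections_elements _ _ _ _ _ _ _ _ Hy Hy') Hpres) as He; cbn in He.
    (* As [e] preserves projections, [c ∘ e] descends to [W × X]; this is the weakly universal
       section. *)
    destruct (regular_epi_descent (t := c ∘ e) Hqq) as [s Hs].
    { intros U a b HU Hab. rewrite <- !comp_assoc. now apply He. }
    exists W, w, s. split; [trivial | split; [ | split]].
    + apply (regular_epi_cancel Hqq). cat. now rewrite Hs, comp_assoc.
    + apply (regular_epi_cancel Hqq). cat. now rewrite Hs, comp_assoc.
    + intros T t s' HT Ht1 Ht2.
      (* A competing section [s'] becomes a competing datum: a cover of the pullback of [s'] and [c]
         is a weak product of [T] and [X], and its second leg [e'] lifts [s'] to [Y]. *)
      destruct (pullback_exists (proj1 exact) s' c) as (L & l1 & l2 & HL).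
      destruct (cover_exists L) as (V' & v & HV' & Hv).
      assert (Hv' : forall (U : E) (b : U ~> T × X), P U ->
        exists a : U ~> V', (l1 ∘ v) ∘ a = b).
      { intros U b HU. destruct (projective_lift (s' ∘ b) HU Hc) as [y Hby].
        destruct (proj2 HL U b y (eq_sym Hby)) as (l & [<- _] & _).
        destruct (projective_lift l HU Hv) as [a <-]. exists a. now rewrite !comp_assoc. }
      assert (Hlv : c ∘ (l2 ∘ v) = s' ∘ (l1 ∘ v)) by now rewrite !comp_assoc, (proj1 HL).
      apply regular_epi_of_lifts in Hv'. revert Hlv Hv'.
      generalize (l1 ∘ v) (l2 ∘ v). clear L l1 l2 HL v Hv. intros r e' He' Hr.
      assert (D1 : @is_weak_product FP (ob T HT) (ob X HX) (ob V' HV') (pr1 ∘ r) (pr2 ∘ r)).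
      { apply weak_product_regular_epi. now rewrite pair_eta. }
      assert (D2 : @preserves_projections FP (ob T HT) (ob X HX) (ob V' HV') (ob Y' HY')
        (ob Y HY) (pr1 ∘ r) (pr2 ∘ r) y1 y2 e').
      { apply (preserves_projections_elements _ _ _ _ _ _ _ _ Hy Hy').
        intros U a b HU Hab. rewrite pair_eta in Hab.
        now rewrite !comp_assoc, He', <- !comp_assoc, Hab. }
      assert (D3 : g1 ∘ c ∘ e' = t ∘ (pr1 ∘ r)).
      { rewrite <- comp_assoc, He', !comp_assoc. now rewrite Ht1. }
      assert (D4 : g2 ∘ c ∘ e' = pr2 ∘ r).
      { rewrite <- comp_assoc, He', !comp_assoc. now rewrite Ht2. }
      destruct (HD (@Build_ESPData FP (ob Y' HY') (ob Y HY) (ob Z HZ) (ob X HX) y1 y2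
        (g1 ∘ c) (g2 ∘ c) (ob T HT) t (ob V' HV') (pr1 ∘ r) (pr2 ∘ r) e' D1 D2 D3 D4))
        as (h & k & Hh & Hk1 & Hk2 & Hk); cbn in *.
      exists h. split; trivial. apply (regular_epi_cancel Hr).
      cat. rewrite <- He', <- Hk, (comp_assoc k), <- Hs, <- Hk1, <- Hk2. now cat.
Qed.

Lemma simple_products_of_weak_sections :
  has_weak_sections -> has_extensional_simple_products FP.
Proof.
  intros WS [Y' HY'] [Y HY] [Z HZ] [X HX] y1 y2 g1 g2 (rho & sigma & tau) Hg1 Hg2; cbn in *.
  destruct (@pseudo_quotient_exists Y' Y y1 y2 rho sigma) as (Q & q & Hq & Hy & Hy').
  { intros U a b HU Hab.
    destruct tau as ([W HW] & p1 & p2 & tau & [_ univ] & Ht1 & Ht2); cbn in *.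
    destruct (univ (ob U HU) a b Hab) as (u & Hua & Hub); cbn in *. subst a b.
    exists (tau ∘ u). now rewrite !comp_assoc, Ht1, Ht2. }
  assert (desc : forall (A : E) (g : Y ~> A), g ∘ y1 = g ∘ y2 -> exists g' : Q ~> A, g' ∘ q = g).
  { intros A g Hg. apply regular_epi_descent; trivial.
    intros U a b HU Hab. destruct (Hy' U a b HU Hab) as (d & <- & <-).
    now rewrite !comp_assoc, Hg. }
  destruct (desc Z g1 Hg1) as [g1' <-], (desc X g2 Hg2) as [g2' <-].
  destruct (WS Q Z X g1' g2' HZ HX) as (W & w & s & HW & Hs1 & Hs2 & univ).
  (* [V] covers the pullback of [s] and [q]. The lifting property [Hlift] makes [r] a regular epi,
     so that [V] is a weak product, and later supplies the arrow [k] from a competing datum. *)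
  destruct (pullback_exists (proj1 exact) s q) as (L & l1 & l2 & HL).
  destruct (cover_exists L) as (V & v & HV & Hv).
  assert (Hlift : forall (U : E) (b : U ~> W × X) (y : U ~> Y), P U -> s ∘ b = q ∘ y ->
    exists a : U ~> V, (l1 ∘ v) ∘ a = b /\ (l2 ∘ v) ∘ a = y).
  { intros U b y HU Hb. destruct (proj2 HL U b y Hb) as (l & [<- <-] & _).
    destruct (projective_lift l HU Hv) as [a <-]. exists a. now rewrite !comp_assoc. }
  assert (Hre : q ∘ (l2 ∘ v) = s ∘ (l1 ∘ v)) by now rewrite !comp_assoc, (proj1 HL).
  revert Hre Hlift. generalize (l1 ∘ v) (l2 ∘ v). clear L l1 l2 HL v Hv. intros r e Hre Hlift.
  assert (Hr : regular_epi r).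
  { apply regular_epi_of_lifts. intros U b HU.
    destruct (projective_lift (s ∘ b) HU Hq) as [y Hby].
    destruct (Hlift U b y HU (eq_sym Hby)) as (a & Ha & _). now exists a. }
  unshelve eexists (@Build_ESPData FP (ob Y' HY') (ob Y HY)
    (ob Z HZ) (ob X HX) y1 y2 (g1' ∘ q) (g2' ∘ q) (ob W HW) w (ob V HV)
    (pr1 ∘ r) (pr2 ∘ r) e _ _ _ _); cbn.
  - apply weak_product_regular_epi; cbn. now rewrite pair_eta.
  - apply (preserves_projections_elements _ _ _ _ _ _ _ _ Hy Hy'); cbn.
    intros U a b HU Hab. rewrite pair_eta in Hab.
    now rewrite !comp_assoc, Hre, <- !comp_assoc, Hab.
  - rewrite <- comp_assoc, Hre, !comp_assoc. now rewrite Hs1.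
  - rewrite <- comp_assoc, Hre, !comp_assoc. now rewrite Hs2.
  - intros [[T HT] t [V' HV'] q1 q2 e' Hwp Hpres H1 H2]; cbn in *.
    apply weak_product_regular_epi in Hwp; cbn in Hwp.
    pose proof (proj1 (preserves_projections_elements _ _ _ _ _ _ _ _ Hy Hy') Hpres) as He; cbn in He.
    destruct (regular_epi_descent (t := q ∘ e') Hwp) as [s' Hs'].
    { intros U a b HU Hab. rewrite <- !comp_assoc. now apply He. }
    destruct (univ T t s' HT) as (h & Hh & Hsh).
    { apply (regular_epi_cancel Hwp). cat. now rewrite Hs', comp_assoc. }
    { apply (regular_epi_cancel Hwp). cat. now rewrite Hs', comp_assoc. }
    destruct (Hlift V' ((h ⋉ X) ∘ ⟨q1, q2⟩) e' HV') as (k & Hk1 & Hk2).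
    { now rewrite comp_assoc, Hsh. }
    exists h, k. rewrite <- !(comp_assoc k), Hk1. cat. auto.
Qed.

(** * Weak sections from exponentials *)

Lemma eval_pair (W F X A T : E) (ev : F × X ~> A) (h : W ~> F) (f : W × X ~> A)
    (a : T ~> W) (b : T ~> X) :
  ev ∘ (h ⋉ X) = f -> ev ∘ ⟨h ∘ a, b⟩ = f ∘ ⟨a, b⟩.
Proof. intros <-. now cat. Qed.

Lemma weak_sections_of_exponentials :
  (forall X A : E, exists (F : E) (ev : F × X ~> A), is_chosen_exponential ev) ->
  has_weak_sections.
Proof.
  intros Exp Q Z X g1 g2 HZ HX.
  destruct (Exp X Q) as (F & ev & Hev), (Exp X (Z × X)) as (G & ev' & Hev').
  (* At a pair of [z] and [s], [u] is the function sending [x] to [⟨g1 (s x), g2 (s x)⟩] and [v] the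
     one sending [x] to [⟨z, x⟩]. They agree exactly when [s] is a section lying over [z]. *)
  destruct (Hev' (Z × F) (⟨g1, g2⟩ ∘ (ev ∘ (pr2 ⋉ X)))) as (u & Hu & _).
  destruct (Hev' (Z × F) (pr1 ⋉ X)) as (v & Hv & _).
  destruct (weak_equalizer_exists u v) as (K & k & Hk & univ).
  destruct (cover_exists K) as (W & c & HW & Hc).
  assert (Hkc : ⟨g1, g2⟩ ∘ (ev ∘ ((pr2 ∘ (k ∘ c)) ⋉ X)) = (pr1 ∘ (k ∘ c)) ⋉ X).
  { pose proof (eval_pair (k ∘ c ∘ pr1) pr2 Hu) as Hu'.
    pose proof (eval_pair (k ∘ c ∘ pr1) pr2 Hv) as Hv'.
    cat in Hu'. cat in Hv'. cat. rewrite <- Hu', <- Hv'.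
    now rewrite !(comp_assoc _ k), Hk. }
  cat in Hkc.
  exists W, (pr1 ∘ (k ∘ c)), (ev ∘ ((pr2 ∘ (k ∘ c)) ⋉ X)). split; [trivial | split; [ | split]].
  - generalize (f_equal (fun x => pr1 ∘ x) Hkc). now cat.
  - generalize (f_equal (fun x => pr2 ∘ x) Hkc). now cat.
  - intros T t s' HT Ht1 Ht2.
    destruct (Hev T s') as (s & Hs & _).
    destruct (univ T ⟨t, s⟩) as (h & Hh).
    (* Both composites are transposes of [t ⋉ X], since [s'] is a section over [t]. *)
    { destruct (Hev' T (t ⋉ X)) as (x & _ & uniq).
      transitivity x; [symmetry | ]; apply uniq.
      - rewrite <- comp_assoc, (eval_pair _ _ Hu). cat. now rewrite Hs, Ht1, Ht2.
      - rewrite <- comp_assoc, (eval_pair _ _ Hv). now cat. }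
    destruct (projective_lift h HT Hc) as [h' <-].
    exists h'. rewrite <- !comp_assoc, !Hh. cat. split; [trivial | ].
    pose proof (f_equal (fun x => pr2 ∘ x ∘ pr1 (B := X)) Hh) as Hh'. cbn beta in Hh'.
    cat in Hh'. now rewrite Hh'.
Qed.

(** * Exponentials from weak sections *)

Section ExponentialsOfWeakSections.
Hypothesis sections : has_weak_sections.

(** A section of the projection from [Z × X × A] amounts to an arrow into [A]. As the base must lie
    in [P], a cover [Z] of the terminal object replaces it; every [T] in [P] has an arrow to [Z] by
    projectivity. *)
Lemma weak_exponential_of_projective (X A : E) :
  P X -> exists (W : E) (ev : W × X ~> A), P W /\
    forall (T : E) (f : T × X ~> A), P T -> exists h : T ~> W, ev ∘ (h ⋉ X) = f.
Proof.
  intros HX. destruct (terminal_exists (proj1 exact)) as [One term].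
  destruct (cover_exists One) as (Z & z & HZ & Hz).
  destruct (@sections (Z × X × A) Z X (pr1 ∘ pr1) (pr2 ∘ pr1) HZ HX)
    as (W & w & s & HW & _ & _ & univ).
  exists W, (pr2 ∘ s). split; [trivial | ]. intros T f HT.
  destruct (term T) as [o _], (projective_lift o HT Hz) as [t _].
  destruct (univ T t ⟨t ⋉ X, f⟩ HT) as (h & _ & Hh); [now cat | now cat | ].
  exists h. rewrite <- comp_assoc, Hh. now cat.
Qed.

(** The equalizer of [u] and [v] has a section over [t] exactly when [t ⋉ X] factors through it. *)
Lemma weak_universal_quantification (Z X A : E) (u v : Z × X ~> A) :
  P Z -> P X -> exists (W : E) (w : W ~> Z), P W /\ u ∘ (w ⋉ X) = v ∘ (w ⋉ X) /\
    forall (T : E) (t : T ~> Z), P T -> u ∘ (t ⋉ X) = v ∘ (t ⋉ X) ->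
      exists h : T ~> W, w ∘ h = t.
Proof.
  intros HZ HX. destruct (weak_equalizer_exists u v) as (K & k & Hk & univ).
  destruct (@sections K Z X (pr1 ∘ k) (pr2 ∘ k) HZ HX)
    as (W & w & s & HW & Hs1 & Hs2 & univ').
  exists W, w. split; [trivial | split].
  - assert (Hs : k ∘ s = w ⋉ X) by (apply pair_ext; cat; now rewrite comp_assoc).
    now rewrite <- Hs, !comp_assoc, Hk.
  - intros T t HT Ht. destruct (univ _ _ Ht) as [s' Hs'].
    destruct (univ' T t s' HT) as (h & Hh & _).
    + rewrite <- comp_assoc, Hs'. now cat.
    + rewrite <- comp_assoc, Hs'. now cat.
    + now exists h.
Qed.

(** Arrows out of [T × X] are arrows out of [T × X0] that agree along the kernel pair of [c].
    Quantifying over its cover [X1] cuts [W] out of the weak exponential [W0] for [X0], and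
    evaluation restricted to [W] descends to [W × X]. *)
Lemma weak_exponential (X A : E) :
  exists (W : E) (ev : W × X ~> A), P W /\
    forall (T : E) (f : T × X ~> A), P T -> exists h : T ~> W, ev ∘ (h ⋉ X) = f.
Proof.
  destruct (cover_exists X) as (X0 & c & HX0 & Hc).
  destruct (pullback_exists (proj1 exact) c c) as (K & k1 & k2 & comm & univK).
  destruct (cover_exists K) as (X1 & d & HX1 & Hd).
  destruct (weak_exponential_of_projective A HX0) as (W0 & ev0 & HW0 & univ0).
  destruct (weak_universal_quantification (ev0 ∘ (W0 ⋊ (k1 ∘ d))) (ev0 ∘ (W0 ⋊ (k2 ∘ d))) HW0 HX1)
    as (W & w & HW & Hw & univ).
  destruct (regular_epi_descent (t := ev0 ∘ (w ⋉ X0)) (times_regular_epi W Hc)) as [ev Hev].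
  { intros U a b HU Hab. cat in Hab.
    assert (Hab1 : pr1 ∘ a = pr1 ∘ b) by (generalize (f_equal (fun x => pr1 ∘ x) Hab); now cat).
    assert (Hab2 : c ∘ (pr2 ∘ a) = c ∘ (pr2 ∘ b))
      by (generalize (f_equal (fun x => pr2 ∘ x) Hab); now cat).
    destruct (univK U _ _ Hab2) as (l & [Hl1 Hl2] & _).
    destruct (projective_lift l HU Hd) as [y <-].
    pose proof (f_equal (fun x => x ∘ ⟨pr1 ∘ a, y⟩) Hw) as H. cbn beta in H. cat in H.
    cat. now rewrite <- Hl1, <- Hl2, <- Hab1. }
  exists W, ev. split; [trivial | ]. intros T f HT.
  destruct (univ0 T (f ∘ (T ⋊ c)) HT) as [h0 Hh0].
  destruct (univ T h0 HT) as [h Hh].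
  { pose proof (eval_pair pr1 (k1 ∘ d ∘ pr2) Hh0) as H1.
    pose proof (eval_pair pr1 (k2 ∘ d ∘ pr2) Hh0) as H2. cat in H1. cat in H2.
    cat. now rewrite H1, H2, !(comp_reassoc _ comm), <- comp_assoc. }
  exists h. apply (regular_epi_cancel (times_regular_epi T Hc)).
  rewrite <- Hh0, <- Hh.
  pose proof (f_equal (fun x => x ∘ (h ⋉ X0)) Hev) as H. cbn beta in H. cat in H.
  now cat.
Qed.

(** Extensional equality is a universal quantification over [X] with parameters in [W × W]; both are
    replaced by covers in [P]. *)
Lemma weak_exponential_equality (W X A : E) (ev : W × X ~> A) :
  exists (R : E) (r1 r2 : R ~> W), P R /\ ev ∘ (r1 ⋉ X) = ev ∘ (r2 ⋉ X) /\
    forall (T : E) (a b : T ~> W), P T -> ev ∘ (a ⋉ X) = ev ∘ (b ⋉ X) ->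
      exists d : T ~> R, r1 ∘ d = a /\ r2 ∘ d = b.
Proof.
  destruct (cover_exists X) as (X0 & c & HX0 & Hc).
  destruct (cover_exists (W × W)) as (Z & z & HZ & Hz).
  destruct (weak_universal_quantification (ev ∘ ⟨pr1 ∘ z ∘ pr1, c ∘ pr2⟩)
    (ev ∘ ⟨pr2 ∘ z ∘ pr1, c ∘ pr2⟩) HZ HX0) as (R & r & HR & Hr & univ).
  exists R, (pr1 ∘ (z ∘ r)), (pr2 ∘ (z ∘ r)). split; [trivial | split].
  - apply (regular_epi_cancel (times_regular_epi R Hc)).
    cat in Hr. now cat.
  - intros T a b HT Hab.
    destruct (projective_lift ⟨a, b⟩ HT Hz) as [t Ht].
    assert (Ht1 : pr1 ∘ (z ∘ t) = a) by (rewrite Ht; now cat).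
    assert (Ht2 : pr2 ∘ (z ∘ t) = b) by (rewrite Ht; now cat).
    destruct (univ T t HT) as [d <-].
    + pose proof (f_equal (fun x => x ∘ (T ⋊ c)) Hab) as H. cbn beta in H.
      rewrite <- Ht1, <- Ht2 in H. cat in H. now cat.
    + exists d. rewrite <- !comp_assoc. now split.
Qed.

Lemma exponential_of_weak_sections (X A : E) :
  exists (F : E) (ev : F × X ~> A), is_chosen_exponential ev.
Proof.
  destruct (weak_exponential X A) as (W & ev & HW & univ).
  destruct (weak_exponential_equality ev) as (R & r1 & r2 & HR & Hr & Hrel).
  assert (Hr' : forall (T : E) (d : T ~> R) (x : T ~> X),
    ev ∘ ⟨r1 ∘ d, x⟩ = ev ∘ ⟨r2 ∘ d, x⟩).
  { intros T d x. pose proof (f_equal (fun y => y ∘ ⟨d, x⟩) Hr) as H. cbn beta in H.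
    now cat in H. }
  destruct (@pseudo_quotient_exists R W r1 r2) as (F & q & Hq & Hqr & Hq').
  - now apply Hrel.
  - now apply Hrel.
  - intros U a b HU Hab. apply Hrel; trivial.
    rewrite <- !comp_assoc, Hr', <- (Hr' _ (b ∘ pr1)), (comp_assoc _ a), Hab. now cat.
  (* Related elements of [W] evaluate alike, so evaluation passes to the quotient [F]. *)
  - destruct (regular_epi_descent (t := ev) (regular_epi_times X Hq)) as [ev' Hev].
    { intros U a b HU Hab. cat in Hab.
      destruct (Hq' U (pr1 ∘ a) (pr1 ∘ b) HU) as (d & Hda & Hdb).
      { generalize (f_equal (fun x => pr1 ∘ x) Hab). now cat. }
      assert (Hab2 : pr2 ∘ a = pr2 ∘ b)
        by (generalize (f_equal (fun x => pr2 ∘ x) Hab); now cat).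
      rewrite <- (pair_eta a), <- (pair_eta b), <- Hda, <- Hdb, Hab2. apply Hr'. }
    assert (Heval : forall (T : E) (h : T ~> W) (x : T ~> X),
      ev' ∘ ⟨q ∘ h, x⟩ = ev ∘ ⟨h, x⟩) by (intros; rewrite <- Hev; now cat).
    exists F, ev'. intros T f.
    (* Weak transposes exist only for domains in [P]. The one over [S] descends to [T] after [q],
       because elements identified by [c] have extensionally equal transposes. *)
    destruct (cover_exists T) as (S & c & HS & Hc).
    destruct (univ S (f ∘ (c ⋉ X)) HS) as [h0 Hh0].
    destruct (regular_epi_descent (t := q ∘ h0) Hc) as [h Hh].
    { intros U a b HU Hab.
      destruct (Hrel U (h0 ∘ a) (h0 ∘ b) HU) as (d & Hda & Hdb).
      - rewrite <- !comp_assoc, !(eval_pair _ _ Hh0). cat.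
        now rewrite !(comp_assoc _ _ c), Hab.
      - now rewrite <- !comp_assoc, <- Hda, <- Hdb, !comp_assoc, Hqr. }
    exists h. split.
    + apply (regular_epi_cancel (regular_epi_times X Hc)). rewrite <- Hh0, <- Heval.
      rewrite comp_assoc, <- Hh. now cat.
    + intros h' Hh'. apply (regular_epi_cancel Hc). rewrite Hh.
      (* For uniqueness, [h' ∘ c] lifts to some [b] in [W] that evaluates like [h0]; the two are
         therefore related and become equal under [q]. *)
      destruct (projective_lift (h' ∘ c) HS Hq) as [b Hb].
      destruct (Hrel S h0 b HS) as (d & <- & <-).
      { rewrite Hh0, <- Hh', <- Heval, comp_assoc, Hb. now cat. }
      now rewrite comp_assoc, Hqr, <- comp_assoc.
Qed.

End ExponentialsOfWeakSections.
End ProjectiveCover.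

Theorem theorem2p14 :
  forall (E : Category) (P : E -> Prop),
    exact_category E -> projective_cover P ->
    (cartesian_closed E <-> has_extensional_simple_products (full_subcategory P)).
Proof.
  intros E P exact proj_cover.
  destruct (binary_products_of_exists (product_exists (proj1 exact))) as [BP].
  split.
  - intros (_ & _ & Exp).
    apply (simple_products_of_weak_sections exact proj_cover).
    apply (weak_sections_of_exponentials exact proj_cover).
    intros X A. destruct (Exp X A) as (F & L & p1 & p2 & ev & Hev).
    exists F. exact (chosen_of_exponential Hev).
  - intros ESP. split; [ | split].
    + apply terminal_exists, exact.
    + apply product_exists, exact.
    + intros X A.
      destruct (exponential_of_weak_sections exact proj_cover
        (weak_sections_of_simple_products exact proj_cover ESP) X A) as (F & ev & Hev).
      exists F, (F × X), pr1, pr2, ev. exact (exponential_of_chosen Hev).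
Qed.
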